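(* Let $n\ge1$, $(p_n,\dots,p_1)\in\{0,1\}^n$, and let $(j_n,\dots,j_1)\in\mathbb Z^n$ satisfy $j_{r+1}-j_r\ge H(p_{r+1},p_r)$ for $1\le r\le n-1$. If the string decomposition of $(j_n,\dots,j_1)$ (with respect to $(p_n,\dots,p_1)$) is of type $(m_M,\dots,m_1)$, then there is an isomorphism of $(\widehat{sl_2})_1$ crystals $$\mathcal B^{p_n,\dots,p_1}_{j_n,\dots,j_1}\ \simeq\ B^{(m_M)}\otimes\cdots\otimes B^{(m_1)}.$$
   Context: **Creation algebra.** $H(0,0)=H(0,1)=H(1,1)=0$, $H(1,0)=1$, $K=1-H$; $\epsilon(j)=0$ for $j$ even, $1$ for $j$ odd. $\mathcal A$ is the associative unital $\mathbb Z$-algebra with generators $\varphi^{\ast p}_j$ ($j\in\mathbb Z$, $p\in\{0,1\}$) and relations $$\varphi^{\ast p_2}_{j_2}\varphi^{\ast p_1}_{j_1}+\varphi^{\ast p_2}_{j_1-2K(p_2,p_1)+\epsilon(j_1+j_2)}\varphi^{\ast p_1}_{j_2+2K(p_2,p_1)-\epsilon(j_1+j_2)}=0,$$ where, if the two monomials coincide, the relation is read as: that monomial is $0$. $B(p_n,\dots,p_1)$ is the set of monomials $\varphi^{\ast p_n}_{a_n}\cdots\varphi^{\ast p_1}_{a_1}$ with $a_{r+1}-a_r\ge 2H(p_{r+1},p_r)$ for $1\le r\le n-1$ (normal monomials). Every monomial with upper indices $(p_n,\dots,p_1)$ is $0$ or $\pm$ a unique element of $B(p_n,\dots,p_1)$.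 **Crystal structure.** An $(\widehat{sl_2})_1$ crystal is an $\widehat{sl_2}$ crystal in which one forgets $\tilde e_0,\tilde f_0$; isomorphisms are bijections commuting with $\tilde e_1,\tilde f_1$ (and preserving the $h_1$-weight, where $\varphi^{\ast p}_j$ has $h_1$-weight $1-2\epsilon(j)$, additive on monomials). On $B(p)=\{\varphi^{\ast p}_j\}$: $\tilde f_1\varphi^{\ast p}_{2j}=\varphi^{\ast p}_{2j+1}$, $\tilde e_1\varphi^{\ast p}_{2j+1}=\varphi^{\ast p}_{2j}$, other actions of $\tilde e_1,\tilde f_1$ being $0$. Tensor product rule (with $\varepsilon_1(b)=\max\{m:\tilde e_1^mb\ne0\}$, $\phi_1(b)=\max\{m:\tilde f_1^mb\neq0\}$): $\tilde f_1(b\otimes b')=\tilde f_1b\otimes b'$ if $\phi_1(b)>\varepsilon_1(b')$, else $b\otimes\tilde f_1b'$; $\tilde e_1(b\otimes b')=\tilde e_1b\otimes b'$ if $\phi_1(b)\ge\varepsilon_1(b')$, else $b\otimes\tilde e_1b'$. The operators $\tilde e_1,\tilde f_1$ on a normal monomial are obtained by applying the operator to the corresponding tensor in $B(p_n)\otimes\cdots\otimes B(p_1)$, multiplying out in $\mathcal A$, and dropping the sign. $B^{(m)}=\{b^{(m)}_0,\dots,b^{(m)}_m\}$ with $\tilde f_1b^{(m)}_i=b^{(m)}_{i+1}$ $(0\le i\le m-1)$, $\tilde e_1b^{(m)}_i=b^{(m)}_{i-1}$ $(1\le i\le m)$, other actions $0$; $b^{(m)}_i$ has $h_1$-weight $m-2i$.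 **The sets $\mathcal B$.** For $(j_n,\dots,j_1)$ as in the claim, $$\mathcal B^{p_n,\dots,p_1}_{j_n,\dots,j_1}=\{\varphi^{\ast p_n}_{2j_n+i_n}\cdots\varphi^{\ast p_1}_{2j_1+i_1}\in B(p_n,\dots,p_1)\ |\ i_1,\dots,i_n\in\{0,1\}\};$$ $\mathcal B^{p_n,\dots,p_1}_{j_n,\dots,j_1}\sqcup\{0\}$ is stable under $\tilde e_1,\tilde f_1$. **Strings.** For given $(p_b,\dots,p_a)$, a sequence $(j_b,\dots,j_a)$ is a string, of length $b-a+1$, if $j_r-j_{r-1}=H(p_r,p_{r-1})$ for $a+1\le r\le b$. The string decomposition of $(j_n,\dots,j_1)$ is the unique choice of $M\ge1$ and $0=r_0<\cdots<r_M=n$ such that $(j_{r_s},\dots,j_{r_{s-1}+1})$ is a string for each $s=1,\dots,M$, and $j_{r_s+1}-j_{r_s}>H(p_{r_s+1},p_{r_s})$ for $s=1,\dots,M-1$. Its type is $(m_M,\dots,m_1)$ with $m_s=r_s-r_{s-1}$. *)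

(* Defs.v *)
From HB Require Import structures.
From mathcomp Require Import all_boot all_order all_algebra.
From mathcomp.multinomials Require Import monalg.
From Stdlib Require Import ClassicalEpsilon.

Set Implicit Arguments.
Unset Strict Implicit.
Unset Printing Implicit Defensive.

Import Order.TTheory GRing.Theory Num.Theory.
Local Open Scope ring_scope.

(* Sequences (s_n, ..., s_1) are stored in the displayed order, so the head of
   the list carries the largest index.  [entry x0 s r] is s_r for
   1 <= r <= size s; x0 is a junk value outside that range. *)
Definition entry (T : Type) (x0 : T) (s : seq T) (r : nat) : T :=
  nth x0 s (size s - r).

(* Upper indices p in {0, 1} are booleans: false is 0, true is 1. *)
Definition H (p2 p1 : bool) : int := if p2 && ~~ p1 then 1 else 0.
Definition K (p2 p1 : bool) : int := 1 - H p2 p1.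

(* (_ %% 2)%Z is the least nonnegative residue, also for negative j. *)
Definition parity (j : int) : int := (j %% 2)%Z.

(* The letter (j, p) stands for the generator phi^{*p}_j. *)
Definition letter : Type := (int * bool)%type.

Definition free_algebra := {malg int[{fmonom letter}]}.

Definition gen (x : letter) : free_algebra := << fmu x >>.

Definition monomial (w : seq letter) : free_algebra := \prod_(x <- w) gen x.

Definition partner (x2 x1 : letter) : seq letter :=
  let: (j2, p2) := x2 in let: (j1, p1) := x1 in
  [:: (j1 - 2 * K p2 p1 + parity (j1 + j2), p2);
      (j2 + 2 * K p2 p1 - parity (j1 + j2), p1)].

(* When the two monomials coincide the relation is m = 0 rather than 2 m = 0. *)
Definition relator (x2 x1 : letter) : free_algebra :=
  if partner x2 x1 == [:: x2; x1] then monomial [:: x2; x1]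
  else monomial [:: x2; x1] + monomial (partner x2 x1).

Inductive relation_ideal : free_algebra -> Prop :=
| relation_ideal0 : relation_ideal 0
| relation_ideal_relator x2 x1 : relation_ideal (relator x2 x1)
| relation_idealD a b :
    relation_ideal a -> relation_ideal b -> relation_ideal (a + b)
| relation_idealM a b c : relation_ideal b -> relation_ideal (a * b * c).

(* The creation algebra is the quotient of [free_algebra] by [relation_ideal];
   it enters only through equality of classes. *)
Definition eq_creation (a b : free_algebra) : Prop := relation_ideal (a - b).

(* The data seen by (sl2-hat)_1 crystals and their isomorphisms; the element 0
   adjoined to the underlying set is [None]. *)
Record crystal := Crystal {
  carrier :> Type;
  e1 : carrier -> option carrier;
  f1 : carrier -> option carrier;
  wt : carrier -> int
}.

(* max {m | g^m b <> 0}; unspecified if there is no such maximum, which does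
   not happen for the crystals below. *)
Definition max_power (T : Type) (g : T -> option T) (b : T) : nat :=
  let power m := iter m (obind g) (Some b) in
  epsilon (inhabits 0%N)
    (fun m => power m <> None /\ forall k, power k <> None -> (k <= m)%N).

Definition eps1 (C : crystal) (b : C) : nat := max_power (@e1 C) b.
Definition phi1 (C : crystal) (b : C) : nat := max_power (@f1 C) b.

Definition tensor (C D : crystal) : crystal :=
  @Crystal (C * D)
    (fun t => if (eps1 t.2 <= phi1 t.1)%N
              then omap (fun b => (b, t.2)) (e1 t.1)
              else omap (fun b => (t.1, b)) (e1 t.2))
    (fun t => if (eps1 t.2 < phi1 t.1)%N
              then omap (fun b => (b, t.2)) (f1 t.1)
              else omap (fun b => (t.1, b)) (f1 t.2))
    (fun t => wt t.1 + wt t.2).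

(* One element of weight 0: the unit for [tensor]. *)
Definition trivial_crystal : crystal :=
  @Crystal unit (fun _ => None) (fun _ => None) (fun _ => 0).

Fixpoint tensors (s : seq crystal) : crystal :=
  if s is C :: s' then tensor C (tensors s') else trivial_crystal.

Definition crystal_isomorphic (C D : crystal) : Prop :=
  exists psi : C -> D,
    [/\ bijective psi,
        forall b, wt (psi b) = wt b,
        forall b, e1 (psi b) = omap psi (e1 b)
      & forall b, f1 (psi b) = omap psi (f1 b)].

(* S together with 0 is stable under e1 and f1. *)
Definition crystal_stable (C : crystal) (S : pred C) : Prop :=
  forall b b' : C, S b -> e1 b = Some b' \/ f1 b = Some b' -> S b'.

(* Meaningful when S is stable: otherwise arrows leaving S are cut. *)
Definition subcrystal (C : crystal) (S : pred C) : crystal :=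
  @Crystal {b : C | S b}
    (fun b => obind insub (e1 (sval b)))
    (fun b => obind insub (f1 (sval b)))
    (fun b => wt (sval b)).

Definition string_crystal (m : nat) : crystal :=
  @Crystal 'I_m.+1
    (fun i => if (0 < i)%N then insub i.-1 else None)
    (fun i => insub i.+1)
    (fun i => m%:Z - 2 * (i : nat)%:Z).

(* B(p); the index j stands for phi^{*p}_j. *)
Definition generator_crystal (p : bool) : crystal :=
  @Crystal int
    (fun j => if parity j == 1 then Some (j - 1) else None)
    (fun j => if parity j == 0 then Some (j + 1) else None)
    (fun j => 1 - 2 * parity j).

(* B(p_n) (x) ... (x) B(p_1) *)
Definition generator_tensors (p : seq bool) : crystal :=
  tensors [seq generator_crystal q | q <- p].

Fixpoint letters (p : seq bool) : generator_tensors p -> seq letter :=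
  if p is q :: p' return generator_tensors p -> seq letter
  then fun t => (t.1, q) :: letters t.2
  else fun _ => [::].

(* [sorted] tests consecutive letters, here (a_{r+1}, p_{r+1}) and (a_r, p_r). *)
Definition normal (w : seq letter) : bool :=
  sorted (fun x y : letter => 2 * H x.2 y.2 <= x.1 - y.1) w.

Definition normal_monomials (p : seq bool) : Type :=
  {t : generator_tensors p | normal (letters t)}.

(* Multiplying out in the creation algebra and dropping the sign. *)
Definition multiplies_to (p : seq bool) (t : generator_tensors p)
    (o : option (normal_monomials p)) : Prop :=
  let m := monomial (letters t) in
  if o is Some v then
    let m' := monomial (letters (sval v)) in
    eq_creation m m' \/ eq_creation m (- m')
  else eq_creation m 0.

Definition multiply_out (p : seq bool) (t : generator_tensors p) :
    option (normal_monomials p) :=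
  epsilon (inhabits None) (multiplies_to t).

(* B(p_n, ..., p_1) *)
Definition normal_crystal (p : seq bool) : crystal :=
  @Crystal (normal_monomials p)
    (fun b => obind (@multiply_out p) (e1 (sval b)))
    (fun b => obind (@multiply_out p) (f1 (sval b)))
    (fun b => wt (sval b)).

(* The subset of the phi^{*p_n}_{2 j_n + i_n} ... phi^{*p_1}_{2 j_1 + i_1} with
   all i_r in {0, 1}. *)
Definition calB (p : seq bool) (j : seq int) : pred (normal_crystal p) :=
  fun b => all2 (fun a k => (a == 2 * k) || (a == 2 * k + 1))
             [seq x.1 | x <- letters (sval b)] j.

(* (j_b, ..., j_a) is a string with respect to (p_b, ..., p_a). *)
Definition is_string (p : seq bool) (j : seq int) (b a : nat) : Prop :=
  forall r, (a.+1 <= r <= b)%N ->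
    entry 0 j r - entry 0 j r.-1 = H (entry false p r) (entry false p r.-1).

(* Only the values r 0, ..., r M of r are relevant. *)
Definition string_decomposition (p : seq bool) (j : seq int)
    (M : nat) (r : nat -> nat) : Prop :=
  [/\ (1 <= M)%N /\ r 0%N = 0%N /\ r M = size j,
      forall s, (s < M)%N -> (r s < r s.+1)%N,
      forall s, (1 <= s <= M)%N -> is_string p j (r s) (r s.-1).+1
    & forall s, (1 <= s <= M.-1)%N ->
        entry 0 j (r s).+1 - entry 0 j (r s)
          > H (entry false p (r s).+1) (entry false p (r s))].

(* m is (m_M, ..., m_1), in this order. *)
Definition string_type (p : seq bool) (j : seq int) (m : seq nat) : Prop :=
  exists r : nat -> nat,
    string_decomposition p j (size m) r /\
    forall s, (1 <= s <= size m)%N -> entry 0%N m s = (r s - r s.-1)%N.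

(* Main.v *)
Require Import Defs.
From mathcomp Require Import all_boot all_order all_algebra perm.
From mathcomp Require Import finmap zify.
From mathcomp.multinomials Require Import monalg.
From Stdlib Require Import ClassicalEpsilon FunctionalExtensionality.
From Stdlib Require Import PropExtensionality.

(** Write an index as 2k + i with i in {0,1}.  The relations of the creation
    algebra keep all the i's and p's in place and, after a shift of the k's that
    depends only on the i's and p's, merely exchange the two shifted k's with a
    sign; a monomial is normal iff its shifted k's strictly decrease from left
    to right.  Hence 0/1 determinants of incidences of shifted k's give linear
    functionals that kill the relations and separate the normal monomials.

    Inside a string, normality says that no 0 stands to the left of a 1, so a
    string of length m carries words 1^x 0^(m-x), i.e. elements of B^(m);
    between strings there is no constraint.  The tensor product rule turns the
    leftmost uncancelled 0 into 1 and the rightmost uncancelled 1 into 0, so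
    normal words of the set stay normal and no straightening is ever needed.
    The isomorphism is built one letter at a time, from the embedding of
    B^(k+1) (x) D into B^(1) (x) (B^(k) (x) D) that splits off the first letter
    of a word. *)

Set Implicit Arguments.
Unset Strict Implicit.
Unset Printing Implicit Defensive.

Import Order.TTheory GRing.Theory Num.Theory.
Local Open Scope ring_scope.

(** * Levels of words and the action of the relations on them *)

Definition half (x : letter) : int := (x.1 %/ 2)%Z.
Definition signature (w : seq letter) : seq (int * bool) :=
  [seq (parity x.1, x.2) | x <- w].

(* The relation at a pair of adjacent letters exchanges k2 + gap and k1. *)
Definition gap (x2 x1 : int * bool) : int :=
  K x2.2 x1.2 - (if (x2.1 == 0) && (x1.1 == 1) then 1 else 0).

(** Adding up the gaps to the right turns the exchange of [k2 + gap] and [k1] into an exchange of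
    two adjacent entries of [levels]. *)
Fixpoint offset (s : seq (int * bool)) : int :=
  if s is x2 :: s' then
    (if s' is x1 :: _ then gap x2 x1 else 0) + offset s'
  else 0.

Fixpoint levels (w : seq letter) : seq int :=
  if w is x :: w' then (half x + offset (signature w)) :: levels w' else [::].

Lemma size_signature w : size (signature w) = size w.
Proof. exact: size_map. Qed.

Lemma size_levels w : size (levels w) = size w.
Proof. by elim: w => //= x w ->. Qed.

Lemma levels_inj v w : signature v = signature w -> levels v = levels w -> v = w.
Proof.
elim: v w => [|[a p] v IHv] [|[b q] w] //= [ab pq vw] [lv lw].
rewrite (IHv _ vw lw); congr (_ :: _); congr (_, _) => //.
rewrite {}vw ab pq in lv; move/addIr: lv; rewrite /half /parity /= in ab * => lv.
by rewrite (divz_eq a 2) (divz_eq b 2) lv ab.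
Qed.

Lemma partner_swaps_levels x2 x1 v : exists y2 y1, [/\ partner x2 x1 = [:: y2; y1],
  signature [:: y2, y1 & v] = signature [:: x2, x1 & v] &
  exists a b, levels [:: x2, x1 & v] = [:: a, b & levels v] /\
    levels [:: y2, y1 & v] = [:: b, a & levels v]].
Proof.
case: x2 x1 => [j2 p2] [j1 p1]; do 2!eexists; split; first by [].
  rewrite /= /parity /K; do 2?[congr ((_, _) :: _)]; case: (H p2 p1); lia.
do 2!eexists; split; first by [].
rewrite /= /half /gap /parity /=.
have -> : ((j1 - 2 * K p2 p1 + ((j1 + j2) %% 2)%Z) %% 2)%Z = (j2 %% 2)%Z by lia.
have -> : ((j2 + 2 * K p2 p1 - ((j1 + j2) %% 2)%Z) %% 2)%Z = (j1 %% 2)%Z by lia.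
do 2?[congr (_ :: _)]; case: ifP; lia.
Qed.

(** The offset of a letter depends only on signatures, which [partner] preserves, so the letters of
    [u] keep their levels. *)
Lemma levels_partner u x2 x1 v :
  signature (u ++ partner x2 x1 ++ v) = signature (u ++ x2 :: x1 :: v) /\
  exists s a b, levels (u ++ x2 :: x1 :: v) = s ++ [:: a, b & levels v] /\
    levels (u ++ partner x2 x1 ++ v) = s ++ [:: b, a & levels v].
Proof.
have [y2 [y1 [-> sv [a [b [lx ly]]]]]] := partner_swaps_levels x2 x1 v.
elim: u => [|z u [IH1 [s [a' [b' [IH2 IH3]]]]]].
  by split; last by exists [::], a, b.
rewrite !cat_cons; split; first by rewrite /signature map_cons -/(signature _) IH1.
exists (half z + offset (signature (z :: u ++ x2 :: x1 :: v)) :: s), a', b'.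
rewrite [levels]lock /= -lock; split; rewrite [LHS]/= ?IH2 //.
by rewrite IH3 /= IH1.
Qed.

(** For indices [2k + i] and [2l + i'], a difference of at least [2 H] means [k - l >= H], or
    [k - l >= H + 1] when [i = 0] and [i' = 1]. This is [k + gap > l]. *)
Lemma levels_sorted w : normal w -> sorted (>%R : rel int) (levels w).
Proof.
rewrite /normal; elim: w => [|[a p] [|[b q] w] IHw] // /andP [ab /IHw] /= ->.
rewrite andbT /half /gap /parity /K /= in ab *.
by case: (H p q) ab; case: ifP; lia.
Qed.

(** * Incidence determinants *)

(** For duplicate-free [t] and [s] of the same length, this is the sign of the permutation relating
    them, or 0 if there is none. *)
Definition incidence (t s : seq int) : int :=
  \det (\matrix_(a < size t, b < size t) (nth 0 s a == nth 0 t b)%:R).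

Lemma incidence_refl t : uniq t -> incidence t t = 1.
Proof.
move=> ut; rewrite /incidence -[RHS](det1 int (size t)); congr (\det _).
by apply/matrixP => a b; rewrite !mxE nth_uniq.
Qed.

(** A nonzero determinant has a nonzero term, hence a permutation matching the entries of [s] with
    those of [t]; strictly decreasing lists with the same entries are equal. *)
Lemma incidence_neq0 t s : size s = size t ->
  sorted (>%R : rel int) s -> sorted (>%R : rel int) t ->
  incidence t s != 0 -> s = t.
Proof.
move=> st ss tt; rewrite /incidence /determinant => nz.
have [/existsP [g gP]|/existsPn no] := boolP [exists g : 'S_(size t),
  [forall a : 'I_(size t), nth 0 s a == nth 0 t (g a)]]; last first.
  case/eqP: nz; apply: big1 => g _.
  have /forallPn [a ha] := no g.
  by rewrite (bigD1 a) //= mxE (negPf ha) mul0r mulr0.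
have usort: transitive (>%R : rel int) by move=> x y z; lia.
have uirr: irreflexive (>%R : rel int) by move=> x; lia.
apply: (irr_sorted_eq usort uirr) => // x.
apply/(nthP 0)/(nthP 0) => [[i hi <-]|[i hi <-]].
  rewrite st in hi; exists (g (Ordinal hi)) => //.
  by rewrite -(eqP (forallP gP (Ordinal hi))).
exists (g^-1 (Ordinal hi))%g; first by rewrite st.
by rewrite (eqP (forallP gP _)) permKV.
Qed.

Lemma incidence_swap t s a b v : size (s ++ [:: a, b & v]) = size t ->
  incidence t (s ++ [:: b, a & v]) = - incidence t (s ++ [:: a, b & v]).
Proof.
rewrite size_cat /= => st; rewrite /incidence.
have h1 : (size s < size t)%N by lia.
have h2 : ((size s).+1 < size t)%N by lia.
set A := (X in _ = - \det X).
transitivity (\det (xrow (Ordinal h1) (Ordinal h2) A)); last first.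
  rewrite xrowE det_mulmx det_perm odd_tperm -val_eqE /=.
  by rewrite (_ : size s != (size s).+1) ?expr1 ?mulN1r //; lia.
congr (\det _); apply/matrixP => i k; rewrite !mxE.
congr ((_ == _)%:R).
case: tpermP => [->|->|/eqP n1 /eqP n2] /=.
- by rewrite !nth_cat ltnn subnn (_ : (_ < _)%N = false) ?subSnn //; lia.
- by rewrite !nth_cat ltnn subnn (_ : (_ < _)%N = false) ?subSnn //; lia.
- rewrite -!val_eqE /= in n1 n2; rewrite !nth_cat; case: ltnP => // h.
  by case E: (i - size s)%N => [|[|r]] //; lia.
Qed.

(** * Linear functionals that vanish on the relations *)

(** For normal [v], this reads off the coefficient of [v] in [w] modulo the relations. *)
Definition word_coord (v w : seq letter) : int :=
  if signature w == signature v then incidence (levels v) (levels w) else 0.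

Lemma word_coord_partner v u x2 x1 z :
  word_coord v (u ++ partner x2 x1 ++ z) = - word_coord v (u ++ x2 :: x1 :: z).
Proof.
rewrite /word_coord; have [-> [s [a [b [l1 l2]]]]] := levels_partner u x2 x1 z.
case: eqP => [sv|]; last by rewrite oppr0.
rewrite l1 l2 incidence_swap // -l1 !size_levels.
by rewrite -size_signature sv size_signature.
Qed.

Lemma word_coord_refl v : normal v -> word_coord v v = 1.
Proof.
move=> nv; rewrite /word_coord eqxx incidence_refl //.
by apply: (sorted_uniq _ _ (levels_sorted nv)) => [x y z|x]; lia.
Qed.

Lemma word_coord_neq0 v w : normal v -> normal w -> word_coord v w != 0 -> w = v.
Proof.
move=> nv nw; rewrite /word_coord; case: ifP => [/eqP sw nz|]; last by rewrite eqxx.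
apply: levels_inj => //; apply: incidence_neq0 => //; try exact: levels_sorted.
by rewrite !size_levels -size_signature sw size_signature.
Qed.

Lemma mulUU (c1 c2 : int) (k1 k2 : {fmonom letter}) :
  << c1 *g k1 >> * << c2 *g k2 >> = << c1 * c2 *g mmul k1 k2 >> :> free_algebra.
Proof. by rewrite malgM_def fgmulUU. Qed.

Lemma monomialE (w : seq letter) : monomial w = << FMonom w >>.
Proof.
rewrite /monomial; elim: w => [|x w IH]; first by rewrite big_nil -fmoneE.
by rewrite big_cons IH mulUU mul1r /gen fmuE -[mmul _ _]/(fmmul _ _) fmmulE.
Qed.

Definition coord (v : seq letter) (b : free_algebra) : int :=
  mmap idfun (fun m : {fmonom letter} => word_coord v m) b.

Lemma coord_monomial v w : coord v (monomial w) = word_coord v w.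
Proof. by rewrite monomialE /coord mmapU /= mul1r. Qed.

Lemma coordD v a b : coord v (a + b) = coord v a + coord v b.
Proof. exact: mmapD. Qed.

Lemma coordN v a : coord v (- a) = - coord v a.
Proof. exact: mmapN. Qed.

(** Reduces two-sided multiples of a relator to multiples by monomials. *)
Lemma mul_monalgE (a r c : free_algebra) : a * r * c =
  \sum_(k <- msupp a) \sum_(l <- msupp c) << a@_k *g k >> * r * << c@_l *g l >>.
Proof.
have -> : a * r = \sum_(k <- msupp a) << a@_k *g k >> * r.
  by rewrite {1}(monalgE a) mulr_suml.
rewrite mulr_suml; apply: eq_bigr => k _.
by rewrite {1}(monalgE c) mulr_sumr.
Qed.

Lemma mulDmul (a b1 b2 c : free_algebra) :
  a * (b1 + b2) * c = a * b1 * c + a * b2 * c.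
Proof. by rewrite mulrDr mulrDl. Qed.

Lemma coord_relation v b : relation_ideal b -> coord v b = 0.
Proof.
move=> hb.
(* Strengthened to all two-sided multiples, so that in the induction the multiplication case is only
   associativity. *)
suff: forall a c, coord v (a * b * c) = 0.
  by move/(_ 1 1); rewrite mul1r mulr1.
elim: hb => {b} [|x2 x1|b1 b2 _ IH1 _ IH2|a b c _ IH] a' c'.
- by rewrite mulr0 mul0r /coord mmap0.
- rewrite mul_monalgE /coord raddf_sum big1 // => k _.
  rewrite raddf_sum big1 //= => l _.
  set x := a'@_k; set y := c'@_l.
  have wcE w : mmap idfun (fun m : {fmonom letter} => word_coord v m)
     (<< x *g k >> * monomial w * << y *g l >>) = x * y * word_coord v (k ++ w ++ l).
    by rewrite monomialE !mulUU mulr1 mmapU !fmM catA.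
  rewrite /relator; case: eqP => [pe|_].
    (* The coordinate is its own opposite, hence 0. *)
    rewrite wcE; have := word_coord_partner v k x2 x1 l.
    rewrite pe !cat_cons cat0s; set d := word_coord _ _ => hd.
    by have -> : d = 0; [lia | rewrite mulr0].
  rewrite mulDmul mmapD.
  (* Rewriting with wcE diverges by unfolding products of {malg _}. *)
  apply: etrans (congr2 +%R (wcE [:: x2; x1]) (wcE (partner x2 x1))) _.
  by rewrite word_coord_partner mulrN addrN.
- rewrite mulDmul coordD.
  exact: etrans (congr2 +%R (IH1 a' c') (IH2 a' c')) (addr0 0).
- have -> : a' * (a * b * c) * c' = (a' * a) * b * (c * c') by rewrite !mulrA.
  exact: IH.
Qed.

(** * Multiplying out fixes normal monomials *)

Lemma letters_inj p : injective (@letters p).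
Proof.
elim: p => [|q p IHp]; first by case=> [] [].
by case=> a t [b u] /= [-> /IHp ->].
Qed.

(** [Some v] is admissible for [epsilon], and it is the only choice: the coordinate at [v] is 1 on
    [v], but 0 on 0 and on every other normal monomial. *)
Lemma multiply_out_normal p (v : normal_monomials p) :
  multiply_out (sval v) = Some v.
Proof.
have h : multiplies_to (sval v) (multiply_out (sval v)).
  apply: epsilon_spec; exists (Some v); left; rewrite /eq_creation subrr.
  exact: relation_ideal0.
case: v h => t nt /= h; have c1 := word_coord_refl nt.
case E: (multiply_out t) h => [[u nu]|] /=; last first.
  by move/(coord_relation (letters t)); rewrite subr0 coord_monomial c1.
move=> h; congr Some; apply: val_inj => /=; apply: letters_inj.
apply: word_coord_neq0 => //; apply/eqP => c0.
by case: h => /(coord_relation (letters t));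
   rewrite coordD !coordN ?opprK !coord_monomial c1 c0.
Qed.

(** * Crystal embeddings and lengths of arrows *)

(** The operators are compared with their zeros included, so the image together with 0 is stable. *)
Definition embedding (C D : crystal) (g : C -> D) : Prop :=
  [/\ injective g,
      forall b, wt (g b) = wt b,
      forall b, e1 (g b) = omap g (e1 b)
    & forall b, f1 (g b) = omap g (f1 b)].

(** The predicates under [epsilon] coincide by extensionality, so the choices agree whether or not a
    maximum exists. *)
Lemma max_power_map (T U : Type) (g : T -> option T) (h : U -> option U) (k : T -> U) :
  (forall b, h (k b) = omap k (g b)) ->
  forall b, max_power h (k b) = max_power g b.
Proof.
move=> hk b.
have pw m : (iter m (obind h) (Some (k b)) <> None) =
    (iter m (obind g) (Some b) <> None).
  have -> : iter m (obind h) (Some (k b)) = omap k (iter m (obind g) (Some b)).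
    by elim: m => //= m ->; case: (iter m _ _) => //= c.
  by apply: propositional_extensionality; case: (iter m _ _).
rewrite /max_power; congr (epsilon _ _); apply: functional_extensionality => m.
rewrite pw; congr (_ /\ _); apply: propositional_extensionality.
by split=> + k' => /(_ k'); rewrite pw.
Qed.

(** By induction on [m], the power [g^m] is nonzero at [c] exactly when [m <= E c]; this gives
    closed formulas for [eps1] and [phi1]. *)
Lemma max_power_rec (T : Type) (g : T -> option T) (E : T -> nat) :
  (forall b, if g b is Some b' then E b = (E b').+1 else E b = 0%N) ->
  forall b, max_power g b = E b.
Proof.
move=> hE b.
have pw m c : iter m (obind g) (Some c) <> None <-> (m <= E c)%N.
  elim: m c => [|m IHm] c //; rewrite iterSr /=.
  case: (g c) (hE c) => [c'|] ->; first by rewrite IHm.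
  by have -> : iter m (obind g) None = None by elim: m {IHm} => //= m ->.
have ex : exists m, iter m (obind g) (Some b) <> None /\
    forall k, iter k (obind g) (Some b) <> None -> (k <= m)%N.
  by exists (E b); split=> [|k]; rewrite pw.
rewrite /max_power; case: (epsilon_spec (inhabits 0%N) _ ex).
set m := epsilon _ _; rewrite pw => le1 /(_ (E b)); rewrite pw leqnn => /(_ isT) le2.
by apply/eqP; rewrite eqn_leq le1.
Qed.

Lemma tensor_embedding (C C' D D' : crystal) (g : C -> C') (h : D -> D') :
  embedding g -> embedding h ->
  @embedding (tensor C D) (tensor C' D') (fun t => (g t.1, h t.2)).
Proof.
move=> [gi gw ge gf] [hi hw he hf].
have hE d : eps1 (h d) = eps1 d by apply: max_power_map.
have gP c : phi1 (g c) = phi1 c by apply: max_power_map.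
split=> [[a b] [c d] /= [/gi -> /hi ->]|[a b]|[a b]|[a b]] //=.
- by rewrite gw hw.
- by rewrite hE gP; case: ifP => _; rewrite ?ge ?he; case: (e1 _).
- by rewrite hE gP; case: ifP => _; rewrite ?gf ?hf; case: (f1 _).
Qed.

(** * Splitting the first letter off a string *)

Lemma phi1_string m (i : string_crystal m) : phi1 i = (m - (i : 'I_m.+1))%N.
Proof.
apply: (@max_power_rec _ _ (fun i : 'I_m.+1 => m - i)%N) => {}i /=.
by have := ltn_ord i; case: insubP => [u /= lu ->|]; lia.
Qed.

(** Forces every chain of [e1] to end, which rules out the junk value of [max_power]. *)
Definition e_finite (C : crystal) : Prop :=
  forall b : C, if e1 b is Some b' then eps1 b = (eps1 b').+1 else eps1 b = 0%N.

(* phi1 of the left factor cancels against eps1 of the right one, by truncated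
   subtraction. *)
Definition tensor_string_eps (k : nat) (D : crystal)
    (t : tensor (string_crystal k) D) : nat :=
  ((t.1 : 'I_k.+1) + (eps1 t.2 - (k - (t.1 : 'I_k.+1))))%N.

Lemma tensor_string_eps_rec k D : e_finite D ->
  forall t : tensor (string_crystal k) D,
  if e1 t is Some t' then tensor_string_eps t = (tensor_string_eps t').+1
  else tensor_string_eps t = 0%N.
Proof.
move=> hD [i d]; rewrite /= phi1_string /tensor_string_eps /=.
have := ltn_ord i; case: (leqP (eps1 d) (k - i)) => ed li.
  case: ifP => [i0|]; last by rewrite /=; lia.
  by case: insubP => [u /= lu eu|] /=; lia.
by have := hD d; case: (e1 d) => [d'|] /=; lia.
Qed.

Lemma eps1_tensor_string k D : e_finite D ->
  forall t : tensor (string_crystal k) D, eps1 t = tensor_string_eps t.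
Proof. by move=> hD; apply: max_power_rec; apply: tensor_string_eps_rec. Qed.

Lemma e_finite_tensor_string k D : e_finite D -> e_finite (tensor (string_crystal k) D).
Proof.
move=> hD t; have := tensor_string_eps_rec hD t.
by case: (e1 t) => [t'|]; rewrite !eps1_tensor_string.
Qed.

Lemma e_finite_string_tensors m : e_finite (tensors [seq string_crystal k | k <- m]).
Proof.
elim: m => [|k m IHm]; last exact: e_finite_tensor_string.
by move=> t /=; apply: (@max_power_rec _ _ (fun=> 0%N)).
Qed.

Lemma e1_tensor (C D : crystal) (b : C) (d : D) : e1 ((b, d) : tensor C D) =
  if (eps1 d <= phi1 b)%N then omap (fun b => (b, d)) (e1 b)
  else omap (fun d => (b, d)) (e1 d).
Proof. by []. Qed.

Lemma f1_tensor (C D : crystal) (b : C) (d : D) : f1 ((b, d) : tensor C D) =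
  if (eps1 d < phi1 b)%N then omap (fun b => (b, d)) (f1 b)
  else omap (fun d => (b, d)) (f1 d).
Proof. by []. Qed.

Lemma e1_string m (i : 'I_m.+1) : e1 (i : string_crystal m) =
  if (0 < i)%N then Some (inord i.-1 : 'I_m.+1) else None.
Proof.
rewrite /=; case: ifP => // i0; have lt : (i.-1 < m.+1)%N by have := ltn_ord i; lia.
by rewrite insubT; congr Some; apply: val_inj; rewrite /= inordK.
Qed.

Lemma f1_string m (i : 'I_m.+1) : f1 (i : string_crystal m) =
  if (i < m)%N then Some (inord i.+1 : 'I_m.+1) else None.
Proof.
rewrite /=; case: ifP => im; last by rewrite insubF // ltnS.
by rewrite insubT; congr Some; apply: val_inj; rewrite /= inordK.
Qed.

(** The element [i] of [B^(k+1)] is the word [1^i 0^(k+1-i)]: its first letter is 1 iff [i > 0], and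
    [i.-1] ones remain, also for [i = 0]. *)
Definition string_split (k : nat) (D : crystal) (t : tensor (string_crystal k.+1) D) :
    tensor (string_crystal 1) (tensor (string_crystal k) D) :=
  (inord (0 < (t.1 : 'I_k.+2))%N, (inord (t.1 : 'I_k.+2).-1, t.2)).

Lemma string_split_embedding k D : e_finite D -> embedding (@string_split k D).
Proof.
move=> hD.
have li (i : 'I_k.+2) : (i < k.+2)%N by apply: ltn_ord.
have v1 (i : 'I_k.+2) : (inord (0 < i)%N : 'I_2) = (0 < i)%N :> nat.
  by rewrite inordK //; case: (0 < i)%N.
have v2 (i : 'I_k.+2) : (inord i.-1 : 'I_k.+1) = i.-1 :> nat.
  by rewrite inordK //; have := li i; lia.
split.
- move=> [i d] [i' d'] [/(congr1 val) /= + /(congr1 val) /= + ->].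
  by rewrite !v1 !v2 => h1 h2; congr (_, _); apply: val_inj => /=; lia.
- by move=> [i d] /=; rewrite v1 v2; lia.
- move=> [i d]; have := li i; rewrite e1_tensor /string_split [fst _]/= [snd _]/=.
  rewrite 2!e1_tensor !e1_string eps1_tensor_string // /tensor_string_eps.
  rewrite !phi1_string [fst _]/= [snd _]/=.
  rewrite !v1 !v2.
  case: (posnP (i : 'I_k.+2)) => i0 ik.
    rewrite i0 /=; case: (leqP (eps1 d) (k.+1 - 0)) => he.
      by rewrite (_ : (_ <= 1 - 0)%N) //; lia.
    rewrite (_ : (_ <= 1 - 0)%N = false); last by lia.
    rewrite (_ : (_ <= k - 0)%N = false); last by lia.
    by case: (e1 d) => //= x; rewrite i0.
  rewrite /=; case: (leqP (eps1 d) (k.+1 - (i : 'I_k.+2))) => he /=; last first.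
    rewrite (_ : (_ <= _)%N = false); last by lia.
    rewrite (_ : (eps1 d <= _)%N = false); last by lia.
    by case: (e1 d) => //= x; rewrite i0.
  rewrite (_ : (inord i.-1 : 'I_k.+2) = i.-1 :> nat); last by rewrite inordK //; lia.
  rewrite (_ : (eps1 d <= k - _)%N); last by lia.
  (* For [i = 1] the leading letter is the only 1 of the string, and [e1] lowers it; for larger [i]
     it acts on the remaining letters. *)
  case: (posnP (i : 'I_k.+2).-1) => i1.
    by rewrite i1 (_ : (_ <= _)%N) //; lia.
  by rewrite (_ : (_ <= _)%N = false) //; lia.
move=> [i d]; have := li i; rewrite f1_tensor /string_split [fst _]/= [snd _]/=.
rewrite 2!f1_tensor !f1_string eps1_tensor_string // /tensor_string_eps.
rewrite !phi1_string [fst _]/= [snd _]/=.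
rewrite !v1 !v2.
case: (posnP (i : 'I_k.+2)) => i0 ik.
  rewrite i0 /=; case: (ltnP (eps1 d) (k.+1 - 0)) => he.
    by rewrite (_ : (_ < 1 - 0)%N) /= ?inordK //; lia.
  rewrite (_ : (_ < 1 - 0)%N = false); last by lia.
  rewrite (_ : (_ < k - 0)%N = false); last by lia.
  by case: (f1 d) => //= x; rewrite i0.
rewrite /=; case: (ltnP (eps1 d) (k.+1 - (i : 'I_k.+2))) => he /=; last first.
  rewrite (_ : (eps1 d < _)%N = false); last by lia.
  by case: (f1 d) => //= x; rewrite i0.
rewrite (_ : (eps1 d < _)%N); last by lia.
rewrite (_ : (i.-1 < k)%N) /=; last by lia.
rewrite (_ : (i < k.+1)%N) /=; last by lia.
by rewrite (_ : (inord i.+1 : 'I_k.+2) = i.+1 :> nat) ?inordK // ?prednK //; lia.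
Qed.

Lemma embedding_comp (C D E : crystal) (g : C -> D) (h : D -> E) :
  embedding g -> embedding h -> embedding (h \o g).
Proof.
move=> [gi gw ge gf] [hi hw he hf]; split=> [|b|b|b] /=.
- exact: inj_comp.
- by rewrite hw gw.
- by rewrite he ge; case: (e1 b).
- by rewrite hf gf; case: (f1 b).
Qed.

(** * Tensor products of strings as words of letters *)

Definition letter_of_bit (q : bool) (a : int) (i : string_crystal 1) :
  generator_crystal q := 2 * a + (i : 'I_2)%:Z.

Lemma letter_of_bit_embedding q a : embedding (@letter_of_bit q a).
Proof.
rewrite /letter_of_bit; split=> [i i' /= h|i|i|i].
- by apply: val_inj => /=; lia.
- by case: i => [[|[|]]] //= _; rewrite /parity; lia.
- rewrite (@e1_string 1 i) /= /parity; case: i => [[|[|]]] //= _.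
    by case: eqP => //; lia.
  by case: eqP => [_|]; last lia; rewrite inordK //= addrK addr0.
- rewrite (@f1_string 1 i) /= /parity; case: i => [[|[|]]] //= _.
    by case: eqP => [_|]; last lia; rewrite inordK //= addr0.
  by case: eqP => //; lia.
Qed.

(** [calB] on raw tensors, with normality as a condition rather than part of the type. *)
Definition in_cal (p : seq bool) (j : seq int) (t : generator_tensors p) : bool :=
  normal (letters t) &&
  all2 (fun a k => (a == 2 * k) || (a == 2 * k + 1)) [seq x.1 | x <- letters t] j.

(* Adds one letter on the left: it opens a new string or extends the leftmost
   one, whose length heads the list. *)
Inductive string_blocks : seq bool -> seq int -> seq nat -> Prop :=
| string_blocks_nil : string_blocks [::] [::] [::]
| string_blocks_new q (a : int) p j m : string_blocks p j m ->
    p = [::] \/ H q (head false p) < a - @head int 0 j ->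
    string_blocks (q :: p) (a :: j) (1%N :: m)
| string_blocks_extend q (a : int) p j k m : string_blocks p j (k :: m) ->
    a - @head int 0 j = H q (head false p) ->
    string_blocks (q :: p) (a :: j) (k.+1 :: m).

(** Induction invariant: normality of a word with one more letter on the left depends on the old
    word only through normality and its first letter. *)
Definition leading_letter (p : seq bool) (j : seq int) (m : seq nat) :
    (tensors [seq string_crystal k | k <- m] -> generator_tensors p) -> Prop :=
  if m is k :: m' return
    (tensors [seq string_crystal k | k <- m] -> generator_tensors p) -> Prop
  then fun g => forall (i : 'I_k.+1) d,
    ohead (letters (g (i, d))) = Some (2 * @head int 0 j + (0 < i)%N%:Z, head false p)
  else fun=> True.

Lemma normal_cons x w : normal (x :: w) =
  (if ohead w is Some y then 2 * H x.2 y.2 <= x.1 - y.1 else true) && normal w.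
Proof. by rewrite /normal; case: w. Qed.

Lemma string_blocks_embedding p j m : string_blocks p j m ->
  exists g : tensors [seq string_crystal k | k <- m] -> generator_tensors p,
  [/\ embedding g, leading_letter j g & forall t, in_cal j t <-> exists b, g b = t].
Proof.
elim=> {p j m} [|q a p j m bl [g [ge gl gi]] new|q a p j k m bl [g [ge gl gi]] ext].
- exists id; split=> // [|t]; first by split=> // b; case: (e1 b).
  by split=> // _; exists t.
- exists (fun t => (letter_of_bit q a t.1, g t.2)); split.
  + exact: tensor_embedding (@letter_of_bit_embedding q a) ge.
  + move=> i d /=; congr (Some (_, _)); rewrite /letter_of_bit.
    by case: i => [[|[|]]].
  + move=> [c t]; rewrite /in_cal [letters _]/= normal_cons /=; split.
      case/andP=> /andP [_ nt] /andP [hc ct].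
      have /gi [d <-] : in_cal j t by rewrite /in_cal nt.
      case/orP: hc => /eqP ->.
        by exists (ord0, d); congr (_, _); rewrite /letter_of_bit addr0.
      by exists (ord_max, d).
    move=> [[i d] [<- e]]; rewrite /= in e.
    have /andP [-> ct] : in_cal j t by apply/gi; exists d.
    rewrite ct !andbT; apply/andP; split; last first.
      by rewrite /letter_of_bit; case: i => [[|[|]]] //= _; lia.
    (* If a letter follows, the gap is at least [H + 1], so the indices differ by at least [2 H + 1]
       whatever the two bits are. *)
    clear e; case: p {bl ge gl gi d} g t new ct => // q' p g [c' t'] [//|].
    case: j => //= a' j new /andP [ht _].
    rewrite /letter_of_bit; have := ltn_ord i; lia.
- exists ((fun t => (letter_of_bit q a t.1, g t.2)) \o @string_split k _); split.
  + pose T := tensors [seq string_crystal k | k <- m].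
    apply: (@embedding_comp (tensor (string_crystal k.+1) T)
      (tensor (string_crystal 1) (tensor (string_crystal k) T))
      (generator_tensors (q :: p)) (@string_split k T)
      (fun t => (letter_of_bit q a t.1, g t.2))).
      by apply: string_split_embedding; apply: e_finite_string_tensors.
    exact: tensor_embedding (@letter_of_bit_embedding q a) ge.
  + move=> i d /=; congr (Some (_, _)); rewrite /letter_of_bit /=.
    by rewrite inordK //; case: (0 < i)%N.
  + move=> [c t]; rewrite /in_cal [letters _]/= normal_cons /=; split.
      case/andP=> /andP [hn nt] /andP [hc ct].
      have /gi [[i d] e] : in_cal j t by rewrite /in_cal nt.
      rewrite -e gl /= in hn; have li := ltn_ord i.
      (* Since [a] exceeds the previous entry by exactly [H], normality says that the new bit is at
         least the next one. A bit 1 fits before any [1^i 0^(k-i)] and gives [i.+1]; a bit 0 forces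
         [i = 0]. *)
      case: (eqVneq c (2 * a + 1)) hc hn => [-> _ _|_ /orP [/eqP ->|] // hn].
        exists (inord i.+1, d) => /=; rewrite /string_split /= inordK //.
        by rewrite -e /letter_of_bit inordK //= inord_val.
      have i0 : i = ord0 by apply: val_inj => /=; lia.
      exists (ord0, d) => /=; rewrite /string_split /=.
      rewrite -e /letter_of_bit inordK //= addr0 i0; congr (_, g (_, _)).
      by apply: val_inj; rewrite /= inordK.
    move=> [[i d] [<- e]]; rewrite /= in e.
    have /andP [-> ->] : in_cal j t by apply/gi; eexists; exact: e.
    have li := ltn_ord i.
    rewrite -e gl /letter_of_bit /= !inordK //; lia.
Qed.

(** * From the embedding to the isomorphism *)

Lemma calB_isomorphic p j m : string_blocks p j m ->
  crystal_stable (@calB p j) /\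
  crystal_isomorphic (subcrystal (@calB p j)) (tensors [seq string_crystal k | k <- m]).
Proof.
move=> /string_blocks_embedding [g [[gi gw ge gf] _ im]].
have ng b : normal (letters (g b)).
  by have /andP [] : in_cal j (g b) by apply/im; exists b.
pose h1 b : normal_crystal p := exist _ (g b) (ng b).
have cg b : @calB p j (h1 b).
  by have /andP [] : in_cal j (g b) by apply/im; exists b.
have preim (v : normal_crystal p) : calB j v -> exists b, v = h1 b.
  case: v => t nt /= ct; have /im [b e] : in_cal j t by rewrite /in_cal nt.
  by exists b; apply: val_inj.
(* Applying [e1] or [f1] stays in the image of [g], which consists of normal words, so multiplying
   out changes nothing. *)
have h1e b : e1 (h1 b) = omap h1 (e1 b).
  rewrite /= ge; case: (e1 b) => //= b'.
  exact: (multiply_out_normal (h1 b')).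
have h1f b : f1 (h1 b) = omap h1 (f1 b).
  rewrite /= gf; case: (f1 b) => //= b'.
  exact: (multiply_out_normal (h1 b')).
split.
  move=> v v' /preim [b ->]; rewrite h1e h1f.
  by case: (e1 b) (f1 b) => [c|] [c'|] /= [] // [<-].
pose h b : subcrystal (@calB p j) := exist _ (h1 b) (cg b).
have hi : injective h by move=> b b' [/gi].
have hsurj v : exists b, h b = v.
  by case: v => v cv; have [b e] := preim v cv; exists b; apply: val_inj.
pose psi v := sval (constructive_indefinite_description _ (hsurj v)).
have hK v : h (psi v) = v by rewrite /psi; case: constructive_indefinite_description.
have psiK b : psi (h b) = b by apply: hi.
have sub b : insub (h1 b) = Some (h b).
  by rewrite insubT; congr Some; apply: val_inj.
exists psi; split.
- by exists h.
- by move=> v; rewrite -{2}(hK v) /= gw.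
- move=> v; rewrite -{2}(hK v) [e1 (h _)]/= -/(e1 (h1 (psi v))).
  have := h1e (psi v); rewrite /= => ->.
  by case: (e1 (psi v)) => //= b; rewrite sub /= psiK.
- move=> v; rewrite -{2}(hK v) [f1 (h _)]/= -/(f1 (h1 (psi v))).
  have := h1f (psi v); rewrite /= => ->.
  by case: (f1 (psi v)) => //= b; rewrite sub /= psiK.
Qed.

(** * String decompositions, one letter at a time *)

Lemma entry_cons (T : Type) (x0 x : T) (s : seq T) (r : nat) :
  (r <= size s)%N -> entry x0 (x :: s) r = entry x0 s r.
Proof. by move=> rs; rewrite /entry /= subSn. Qed.

Lemma entry_cons_int (a : int) (j : seq int) (r : nat) :
  (r <= size j)%N -> entry 0 (a :: j) r = entry 0 j r.
Proof. exact: entry_cons. Qed.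

Lemma entry_last (T : Type) (x0 x : T) (s : seq T) :
  entry x0 (x :: s) (size s).+1 = x.
Proof. by rewrite /entry /= subnn. Qed.

Lemma entry_size (T : Type) (x0 : T) (s : seq T) : entry x0 s (size s) = head x0 s.
Proof. by rewrite /entry subnn nth0. Qed.

Lemma is_string_cons q p a j b c : size p = size j -> (b <= size j)%N ->
  is_string (q :: p) (a :: j) b c -> is_string p j b c.
Proof.
move=> pj bj h r hr; have := h r hr.
by rewrite !entry_cons_int ?entry_cons //; lia.
Qed.

(** Induction removing the leftmost letter: a leftmost string of length 1 disappears, a longer one
    is shortened. *)
Lemma string_blocks_of_decomposition (p : seq bool) (j : seq int) (m : seq nat)
    (r : nat -> nat) :
  size p = size j -> r 0%N = 0%N -> r (size m) = size j ->
  (forall s, (s < size m)%N -> (r s < r s.+1)%N) ->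
  (forall s, (1 <= s <= size m)%N -> is_string p j (r s) (r s.-1).+1) ->
  (forall s, (1 <= s <= (size m).-1)%N ->
     entry 0 j (r s).+1 - entry 0 j (r s)
       > H (entry false p (r s).+1) (entry false p (r s))) ->
  (forall s, (1 <= s <= size m)%N -> entry 0%N m s = (r s - r s.-1)%N) ->
  string_blocks p j m.
Proof.
elim: j p m r => [|a j IHj] [|q p] [|k m] r //= pj r0 rM inc str gap typ.
- exact: string_blocks_nil.
- by have := inc (size m) (leqnn _); rewrite rM.
- by rewrite r0 in rM.
case: pj => pj.
have mono s : (s <= size m)%N -> (r s <= r (size m))%N.
  move=> /subKn <-; elim: (size m - s)%N => [|d IHd]; first by rewrite subn0.
  apply: leq_trans IHd; case: (ltnP d (size m)) => hd.
    by rewrite -(subnSK hd) ltnW // inc //; lia.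
  by have -> : (size m - d.+1 = size m - d)%N by lia.
have kE : k = ((size j).+1 - r (size m))%N.
  by have := typ (size m).+1; rewrite -rM entry_last ltnSn => ->.
have lt := inc (size m) (ltnSn _); rewrite rM in lt.
have aE : entry 0 (a :: j) (size j).+1 = a by apply: entry_last.
have jE : entry 0 (a :: j) (size j) = @head int 0 j.
  by rewrite entry_cons_int // entry_size.
have qE : entry false (q :: p) (size j).+1 = q by rewrite -pj entry_last.
have pE : entry false (q :: p) (size j) = head false p.
  by rewrite -pj entry_cons // entry_size.
have [k1|k1] := eqVneq k 1%N.
  rewrite k1; have rm : r (size m) = size j by lia.
  apply: string_blocks_new.
    apply: (IHj _ _ r) => //.
    - by move=> s hs; apply: inc; lia.
    - move=> s hs; apply: (@is_string_cons q p a) => //.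
        by rewrite -rm mono //; lia.
      by apply: str; lia.
    - move=> s hs; have rs : (r s < size j)%N.
        by rewrite -rm; apply: leq_trans (inc s _) (mono _ _); lia.
      by have := gap s; rewrite !entry_cons_int ?entry_cons //; lia.
    - by move=> s hs; rewrite -(typ s) ?entry_cons //; lia.
  case: m {IHj mono kE typ str inc} gap rm {rM lt} => [|l m] gap rm.
    by left; apply: size0nil; rewrite pj -rm r0.
  right; have := gap (size m).+1; rewrite rm aE qE jE pE /= leqnn.
  exact.
have k2 : (2 <= k)%N by lia.
rewrite -(prednK (ltnW k2)).
apply: string_blocks_extend.
  (* The number of strings is unchanged; only the last value of [r] drops by one, to [size j]. *)
  apply: (IHj _ _ (fun s => if s == (size m).+1 then size j else r s)) => //=.
  - by rewrite eqxx.
  - move=> s hs; rewrite (_ : (s == _) = false); last by lia.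
    case: eqP => [[->]|ne]; [by lia|exact: inc].
  - move=> s hs; rewrite (_ : (s.-1 == _) = false); last by lia.
    apply: (@is_string_cons q p a) => //.
      case: eqP => // ne; have -> // := leq_trans (mono s _); lia.
    case: eqP => [e|ne]; last by apply: str.
    by move=> i hi; apply: (str s hs); rewrite e rM -e; lia.
  - move=> s hs; rewrite (_ : (s == _) = false); last by lia.
    have rs : (r s < size j)%N by have := mono s; lia.
    by have := gap s hs; rewrite !entry_cons_int ?entry_cons //; lia.
  - move=> s hs; rewrite (_ : (s.-1 == _) = false); last by lia.
    case: eqP => [->|ne]; first by rewrite /entry /= subnn /= kE; lia.
    by rewrite -(typ s) // !entry_cons //; lia.
have := str (size m).+1; rewrite ltnSn /= => /(_ isT (size j).+1).
by rewrite rM aE qE jE pE; apply; lia.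
Qed.

Theorem theorem5 (n : nat) (hn : (1 <= n)%N)
    (p : n.-tuple bool) (j : n.-tuple int)
    (hj : forall r : nat, (1 <= r <= n.-1)%N ->
       entry 0 j r.+1 - entry 0 j r
         >= H (entry false p r.+1) (entry false p r))
    (m : seq nat) (hm : string_type p j m) :
  crystal_stable (@calB p j) /\
  crystal_isomorphic (subcrystal (@calB p j))
    (tensors [seq string_crystal k | k <- m]).
Proof.
case: hm => r [[[_ [r0 rM]] inc str gap] typ]; apply: calB_isomorphic.
have pj : size p = size j by rewrite !size_tuple.
exact: string_blocks_of_decomposition pj r0 rM inc str gap typ.
Qed.
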